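(* Let $G$ be a graph and $H$ a subgraph of $G$ such that $C(G)\searrow^{d}C(H)$. Then $G^{\circ}\searrow^{d}H^{\circ}$. In particular, if $G$ is a reflexive graph and $H$ is a reflexive subgraph of $G$, then $C(G)\searrow^{d}C(H)$ implies $G\searrow^{d}H$.
   Context: Graphs are finite, undirected, without parallel edges; loops are allowed; a graph is reflexive if every vertex is looped. $G^{\circ}$ denotes the reflexive graph obtained from $G$ by adding loops to its non-looped vertices. $N_G(x)=\{y: y\sim x\}$ is the open neighborhood. A vertex $x$ of $G$ is dismantlable if there is a vertex $a\neq x$ with $N_G(x)\subset N_G(a)$. For a subgraph $H$ of $G$, $G\searrow^{d}H$ means: $H$ is the subgraph of $G$ induced by $V(H)$ and one can write $V(G)\setminus V(H)=\{x_1,\dots,x_k\}$ ($k\ge0$, distinct) so that each $x_i$ is dismantlable in the subgraph of $G$ induced by $V(H)\cup\{x_i,\dots,x_k\}$. A complete subgraph of $G$ is an induced subgraph in which any two distinct vertices are adjacent; it is identified with its vertex set. $C(G)$ is the poset of nonempty complete subgraphs of $G$ ordered by inclusion; for a subgraph $H$ of $G$, $C(H)$ is a subposet of $C(G)$. In a finite poset $P$, an element $p$ is dismantlable if $P_{>p}=\{y\in P:y>p\}$ has a least element or $P_{<p}=\{y\in P:y<p\}$ has a greatest element. For posets, $P\searrow^{d}Q$ means that one can go from $P$ to the subposet $Q$ by successively deleting elements, each dismantlable in the poset from which it is deleted. *)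

(* Defs.v *)
From HB Require Import structures.
From mathcomp Require Import all_boot all_order.

Set Implicit Arguments.
Unset Strict Implicit.
Unset Printing Implicit Defensive.

Import Order.TTheory.

(** Makes inclusion the canonical order on [{set V}]. *)
Export Order.DefaultSetSubsetOrder.

(** Finite graphs without parallel edges, loops allowed.  Vertex sets are
    subsets of an ambient finite type [V], so that a graph and its subgraphs
    have the same type. *)
Record graph (V : finType) := Graph {
  vset : {set V};
  adj : rel V;
  adj_sym : symmetric adj;
  adj_vset : forall x y, adj x y -> x \in vset
}.

Section Graphs.
Variable V : finType.
Implicit Types (G H : graph V) (A K : {set V}) (x y : V).

Definition reflexive_graph G : Prop := {in vset G, forall x, adj G x x}.

(** Not necessarily induced. *)
Definition subgraph H G : Prop :=
  vset H \subset vset G /\ subrel (adj H) (adj G).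

Definition induced_subgraph H G : Prop :=
  vset H \subset vset G /\ {in vset H &, adj H =2 adj G}.

Section Induced.
Variables (G : graph V) (A : {set V}).

Definition induced_adj : rel V :=
  fun x y => [&& x \in A, y \in A & adj G x y].

Fact induced_adj_sym : symmetric induced_adj.
Proof. by move=> x y; rewrite /induced_adj andbCA adj_sym. Qed.

Fact induced_adj_vset x y : induced_adj x y -> x \in vset G :&: A.
Proof. by case/and3P=> xA _ /adj_vset xG; rewrite inE xG xA. Qed.

Definition induced : graph V := Graph induced_adj_sym induced_adj_vset.
End Induced.

Section AddLoops.
Variable G : graph V.

Definition loop_adj : rel V :=
  fun x y => adj G x y || ((x == y) && (x \in vset G)).

Fact loop_adj_sym : symmetric loop_adj.
Proof.
by move=> x y; rewrite /loop_adj adj_sym (eq_sym x); case: eqP => [->|].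
Qed.

Fact loop_adj_vset x y : loop_adj x y -> x \in vset G.
Proof. by case/orP=> [/adj_vset|/andP[]]. Qed.

Definition add_loops : graph V := Graph loop_adj_sym loop_adj_vset.
End AddLoops.

Definition open_nbhd G x : {set V} := [set y | adj G x y].

Definition dismantlable_vertex G x : Prop :=
  x \in vset G /\
  exists a, [/\ a \in vset G, a != x & open_nbhd G x \subset open_nbhd G a].

(** [s] lists the deleted vertices in order of deletion; when [x] is about to
    be deleted, the remaining ones are those of [x :: s2]. *)
Definition graph_dismantles G H : Prop :=
  induced_subgraph H G /\
  exists s : seq V,
    [/\ uniq s,
        [set x in s] = vset G :\: vset H &
        forall s1 x s2, s = s1 ++ x :: s2 ->
          dismantlable_vertex
            (induced G (vset H :|: [set y in x :: s2])) x].

Definition complete G K : bool :=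
  (K \subset vset G) && [forall x in K, forall y in K, (x != y) ==> adj G x y].

Definition complete_poset G : {set {set V}} :=
  [set K : {set V} | (K != set0) && complete G K].

End Graphs.

(** Finite posets are subsets of a [finPOrderType], with the induced order. *)
Section Posets.
Variables (d : Order.disp_t) (T : finPOrderType d).
Implicit Types (P Q A : {set T}) (p : T).
Local Open Scope order_scope.

Definition has_least A : Prop :=
  exists2 m, m \in A & {in A, forall y, m <= y}.

Definition has_greatest A : Prop :=
  exists2 m, m \in A & {in A, forall y, y <= m}.

Definition dismantlable_element P p : Prop :=
  p \in P /\
  (has_least [set y in P | p < y] \/ has_greatest [set y in P | y < p]).

Inductive poset_dismantles : {set T} -> {set T} -> Prop :=
| poset_dismantles_refl P : poset_dismantles P P
| poset_dismantles_step P Q p :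
    dismantlable_element P p -> poset_dismantles (P :\ p) Q ->
    poset_dismantles P Q.

End Posets.

(* Main.v *)
Require Import Defs.
From mathcomp Require Import all_boot all_order.

(** A dismantling of the poset [C(G)] onto [C(H)] yields a monotone retraction
    of [C(G)] onto [C(H)], reached from the identity through monotone maps that
    fix [C(H)] and are consecutively comparable
    ([poset_dismantles_retraction]).

    On the graph side, delete dismantlable vertices outside [H] for as long as
    there are any ([dismantle_to_stiff]).  What remains is a vertex set [A]
    containing [V(H)], with a homomorphic retraction [r] of [G] onto [A], such
    that no vertex of [A] outside [H] is dismantlable in the subgraph induced
    by [A].

    The chain of maps cannot move the vertices of [A]: if [f] and [g] are
    consecutive, and [r] sends [f [set x]] to [x] for all [x] in [A], then the
    same is true of [g].  Indeed, for [y] adjacent to [x], the sets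
    [f [set y]] and [g [set x]] lie in one complete subgraph, namely the larger
    of the images of [[set x; y]] under [f] and [g].  Hence any vertex
    [v] of [g [set x]] has [r v] adjacent to every neighbour [y] of [x] in [A],
    and [r v != x] would make [x] dismantlable in [A].  At the end of the chain
    [f [set x]] is a complete subgraph of [H], on which [r] is the identity, so
    every [x] in [A] belongs to [H].

    Adding loops changes no complete subgraph, so it is enough to treat
    reflexive graphs. *)

Set Implicit Arguments.
Unset Strict Implicit.
Unset Printing Implicit Defensive.

Import Order.TTheory.

(** * Monotone retractions of dismantlable posets *)

Section PosetRetraction.
Variables (d : Order.disp_t) (T : finPOrderType d).
Implicit Types (P Q : {set T}) (f g : T -> T).
Local Open Scope order_scope.

(** For [P' = Q] and [Q] contained in [P], these are the monotone retractions
    of [P] onto [Q]. *)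
Definition monotone_rel P P' Q f : Prop :=
  [/\ {in P &, {homo f : x y / x <= y}},
      {in P, forall x, f x \in P'} &
      {in Q, forall x, f x = x}].

Definition comparable_on P f g : Prop :=
  {in P, forall x, f x <= g x} \/ {in P, forall x, g x <= f x}.

Lemma poset_dismantles_sub P Q : poset_dismantles P Q -> Q \subset P.
Proof.
elim=> // {}P {}Q p _ _ sQ; exact: subset_trans sQ (subsetDl _ _).
Qed.

(** Sending a dismantlable element to the least element above it, or to the
    greatest one below it, retracts the poset onto the remaining elements. *)
Lemma dismantlable_element_retraction P p :
  dismantlable_element P p ->
  exists2 h, monotone_rel P (P :\ p) (P :\ p) h & comparable_on P id h.
Proof.
case=> pP [] [m]; rewrite inE => /andP[mP ltm] mB.
- exists (fun x => if x == p then m else x); last first.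
    by left=> x _ /=; case: eqP => [->|//]; exact: ltW.
  split.
  + move=> x y xP yP lexy; case: (eqVneq x p) => [xp|nxp].
      case: (eqVneq y p) => [//|nyp]; apply: mB.
      by rewrite inE yP lt_neqAle eq_sym nyp -xp.
    case: (eqVneq y p) => [yp|//].
    by apply: le_trans (ltW ltm); rewrite -yp.
  + move=> x xP; case: (eqVneq x p) => [_|nxp]; rewrite !inE ?nxp ?xP //.
    by rewrite mP (gt_eqF ltm).
  + by move=> x; rewrite !inE => /andP[/negbTE-> _].
- exists (fun x => if x == p then m else x); last first.
    by right=> x _ /=; case: eqP => [->|//]; exact: ltW.
  split.
  + move=> x y xP yP lexy; case: (eqVneq y p) => [yp|nyp].
      case: (eqVneq x p) => [//|nxp]; apply: mB.
      by rewrite inE xP lt_neqAle nxp -yp.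
    case: (eqVneq x p) => [xp|//].
    by apply: le_trans (ltW ltm) _; rewrite -xp.
  + move=> x xP; case: (eqVneq x p) => [_|nxp]; rewrite !inE ?nxp ?xP //.
    by rewrite mP (lt_eqF ltm).
  + by move=> x; rewrite !inE => /andP[/negbTE-> _].
Qed.

(** Homotopy form of dismantling: a property of maps that passes from a map to
    any comparable one, both being monotone and fixing [Q], passes from the
    identity of [P] to some retraction of [P] onto [Q]. *)
Lemma poset_dismantles_retraction P Q (I : (T -> T) -> Prop) :
  poset_dismantles P Q -> I id ->
  (forall f g, monotone_rel P P Q f -> monotone_rel P P Q g ->
     comparable_on P f g -> I f -> I g) ->
  exists2 f, monotone_rel P Q Q f & I f.
Proof.
move=> PQ Iid step.
have widen (R : {set T}) f : R \subset P -> monotone_rel P R Q f -> monotone_rel P P Q f.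
  by move=> sR [fM fR fQ]; split=> // x /fR; exact: (subsetP sR).
(* The domain [P] stays fixed while the poset [R] being dismantled shrinks. *)
suff gen (R S : {set T}) : poset_dismantles R S -> S = Q -> R \subset P ->
    forall f, monotone_rel P R Q f -> I f ->
    exists2 g, monotone_rel P Q Q g & I g.
  by apply: (gen P Q PQ erefl _ id) => //; split.
elim=> {R S} [R -> _ f fR If|R S p pR RS IH SQ sR f fR If]; first by exists f.
have [h [hM hR hf] hcmp] := dismantlable_element_retraction pR.
have sQR : Q \subset R :\ p by rewrite -SQ; exact: poset_dismantles_sub RS.
have sR' : R :\ p \subset P := subset_trans (subsetDl _ _) sR.
case: (fR) => fM fPR fQ.
have hfR : monotone_rel P (R :\ p) Q (h \o f).
  split=> [x y xP yP lexy|x xP|x xQ] /=.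
  - by apply: hM; rewrite ?fPR //; apply: fM.
  - by apply: hR; apply: fPR.
  - by rewrite fQ // hf // (subsetP sQR).
apply: (IH SQ sR' _ hfR); apply: step If; [exact: widen fR|exact: widen hfR|].
by case: hcmp => hc; [left|right] => x xP; apply: hc; apply: fPR.
Qed.

End PosetRetraction.

(** * Stiff induced subgraphs *)

Section StiffSubgraph.
Variable V : finType.
Implicit Types (G H : graph V) (A B : {set V}) (x y : V).

Lemma dismantlable_inducedP G A x : A \subset vset G ->
  reflect (dismantlable_vertex (induced G A) x)
    ((x \in A) &&
     [exists a in A, (a != x) &&
        [forall y in A, adj G x y ==> adj G a y]]).
Proof.
move=> sA; have vA : vset (induced G A) = A by apply/setIidPr.
apply: (iffP andP) => [[xA /exists_inP[a aA /andP[ax /forall_inP xa]]]|].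
  split; rewrite vA //; exists a; split; rewrite ?vA //.
  apply/subsetP=> y; rewrite !inE /= /induced_adj => /and3P[_ yA xy].
  by rewrite aA yA (implyP (xa y yA)).
case; rewrite vA => xA [a [aA ax /subsetP xa]].
split=> //; apply/exists_inP; exists a => //; rewrite ax.
apply/forall_inP=> y yA; apply/implyP=> xy.
have := xa y; rewrite !inE /= /induced_adj xA yA xy => /(_ isT).
by case/and3P.
Qed.

(** Greedy deletion of dismantlable vertices outside [B].  The retraction [r]
    composes the maps sending each deleted vertex to one that dominates it. *)
Lemma dismantle_to_stiff G A B : B \subset A -> A \subset vset G ->
  exists (C : {set V}) (s : seq V) (r : V -> V),
  [/\ B \subset C, C \subset A,
      [/\ uniq s, [set x in s] = A :\: C &
        forall s1 x s2, s = s1 ++ x :: s2 ->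
          dismantlable_vertex (induced G (C :|: [set y in x :: s2])) x],
      [/\ {in A, forall x, r x \in C}, {in C, forall x, r x = x} &
        {in A &, {homo r : x y / adj G x y}}] &
      {in C :\: B, forall x, ~ dismantlable_vertex (induced G C) x}].
Proof.
have [n] := ubnP #|A|; elim: n A => // n IH A leAn sBA sAG.
pose P x := (x \in A :\: B) && ((x \in A) &&
     [exists a in A, (a != x) && [forall y in A, adj G x y ==> adj G a y]]).
case: (pickP P) => [x /andP[]|nP]; last first.
  exists A, [::], id; split=> //.
  - by split=> //; [rewrite setDv; apply/setP=> x; rewrite !inE|case].
  - by split.
  move=> x xAB /(dismantlable_inducedP _ sAG) dx.
  by have := nP x; rewrite /P xAB dx.
rewrite inE => /andP[xB xA] dx.
have sA' : A :\ x \subset A := subsetDl _ _.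
have [|||C [s [r]]] := IH (A :\ x).
- by move: leAn; rewrite (cardsD1 x) xA.
- by rewrite subsetD1 sBA xB.
- exact: subset_trans sAG.
case=> sBC sCA' [us es ds] [rC rid rhom] stiff.
have xC : x \notin C by move: sCA'; rewrite subsetD1 => /andP[].
have sCA : C \subset A := subset_trans sCA' sA'.
have eA : C :|: [set y in x :: s] = A.
  apply/setP=> y; move/setP/(_ y): es; rewrite !inE => ->.
  have [->|_] := eqVneq y x; first by rewrite xA orbT.
  by have := subsetP sCA y; case: (y \in C) => // ->.
have /(dismantlable_inducedP _ sAG) xdom := dx.
case/andP: dx => _ /exists_inP[a aA /andP[ax /forall_inP dom]].
have {}dom y : y \in A -> adj G x y -> adj G a y.
  by move=> yA; exact/implyP/dom.
pose t z := if z == x then a else z.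
have tA z : z \in A -> t z \in A :\ x.
  by move=> zA; rewrite /t; case: eqP => [_|/eqP zx]; rewrite !inE ?ax ?zx.
exists C, (x :: s), (r \o t); split=> //.
- split=> [||[|z s1] y s2 [exy es2]].
  + by move/setP/(_ x): es; rewrite !inE eqxx andbF /= us => ->.
  + apply/setP=> y; move/setP/(_ y): es; rewrite !inE => ->.
    by have [->|] := eqVneq y x; rewrite ?xA ?xC.
  + by rewrite -exy -es2 eA.
  + by apply: (ds s1); rewrite es2.
- split=> [z zA|z zC|z w zA wA zw] /=; first by apply: rC; apply: tA.
    by rewrite /t; case: eqP => [zx|_]; [rewrite -zx zC in xC|exact: rid].
  apply: rhom; rewrite ?tA // /t.
  case: eqP zw => [->|_] zw; case: eqP zw => [->|_] zw //.
  + by apply: (dom) => //; rewrite adj_sym; apply: dom.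
  + exact: dom.
  + by rewrite adj_sym; apply: dom; rewrite // adj_sym.
Qed.

End StiffSubgraph.

(** * Complete subgraphs and the dismantling theorem *)

Section CompletePoset.
Variable V : finType.
Implicit Types (G H : graph V) (K : {set V}) (x y : V).

Lemma le_setE (A B : {set V}) : (A <= B)%O = (A \subset B).
Proof. exact: Order.SetSubsetOrder.leEsubset. Qed.

Lemma complete_poset_add_loops G :
  complete_poset (add_loops G) = complete_poset G.
Proof.
apply/setP=> K; rewrite !inE /complete /=; congr [&& _, _ & _].
apply: eq_forallb_in => x _; apply: eq_forallb_in => y _.
by rewrite /= /loop_adj; case: eqP; rewrite ?orbF.
Qed.

Lemma complete_poset_adj G K x y : reflexive_graph G ->
  K \in complete_poset G -> x \in K -> y \in K -> adj G x y.
Proof.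
move=> rG; rewrite inE => /and3P[_ /subsetP sK /forall_inP cK] xK yK.
have [<-|xy] := eqVneq x y; first exact/rG/sK.
by have /forall_inP/(_ y yK) := cK x xK; rewrite xy.
Qed.

Lemma complete_poset_set2 G x y :
  adj G x y -> [set x; y] \in complete_poset G.
Proof.
move=> xy; have yx : adj G y x by rewrite adj_sym.
rewrite inE; apply/and3P; split.
- by apply/set0Pn; exists x; rewrite !inE eqxx.
- by apply/subsetP=> z; rewrite !inE => /orP[]/eqP->; apply: adj_vset; eassumption.
apply/forall_inP=> z /set2P zxy; apply/forall_inP=> w /set2P wxy.
by case: zxy wxy => -> [] ->; rewrite ?eqxx ?xy ?yx ?implybT.
Qed.

Lemma complete_poset_set1 G x :
  x \in vset G -> [set x] \in complete_poset G.
Proof.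
move=> xG; rewrite inE /complete sub1set xG /=; apply/andP; split.
  by apply/set0Pn; exists x; rewrite inE.
apply/forall_inP=> y /set1P->; apply/forall_inP=> z /set1P->.
by rewrite eqxx.
Qed.

Lemma complete_poset_neq0 G K :
  K \in complete_poset G -> exists x, x \in K.
Proof. by rewrite inE => /andP[/set0Pn]. Qed.

Lemma complete_poset_sub G K x :
  K \in complete_poset G -> x \in K -> x \in vset G.
Proof. by rewrite inE => /and3P[_ /subsetP sK _] /sK. Qed.

(** The chain from the identity to the retraction of [C(G)] onto [C(H)] fixes,
    up to the graph retraction [r], each vertex of a stiff [A] containing
    [V(H)]; this forces [A] to be [V(H)]. *)
Lemma reflexive_complete_dismantles G H :
  reflexive_graph G -> reflexive_graph H -> subgraph H G ->
  poset_dismantles (complete_poset G) (complete_poset H) ->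
  graph_dismantles G H.
Proof.
move=> rG rH [sHG aHG] hC.
have [A [s [r [sHA sAG [us es ds] [rA rid rhom] stiff]]]] :=
  dismantle_to_stiff sHG (subxx (vset G)).
have AG x : x \in A -> x \in vset G by exact: (subsetP sAG).
pose I (f : {set V} -> {set V}) :=
  {in A, forall x, {in f [set x], forall v, r v = x}}.
have Iid : I id by move=> x xA v /set1P->; exact: rid.
have [|f [fM fH fid] If] := poset_dismantles_retraction hC Iid.
  move=> f g [fM fG fid] [gM gG gid] cmp If x xA v vgx.
  have xG := AG x xA.
  have vG : v \in vset G.
    by apply: complete_poset_sub vgx; apply/gG/complete_poset_set1.
  case: (boolP (x \in vset H)) => [xH|nxH].
    by move: vgx; rewrite gid ?complete_poset_set1 // => /set1P->; exact: rid.
  (* Otherwise [r v] dominates [x] in [A], against stiffness. *)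
  apply/eqP/negPn/negP=> rvx; apply: (stiff x); first by rewrite inE nxH xA.
  apply/(dismantlable_inducedP _ sAG); rewrite xA; apply/exists_inP.
  exists (r v); rewrite ?rA // rvx; apply/forall_inP=> y yA; apply/implyP=> xy.
  have yG := AG y yA.
  have xyG := complete_poset_set2 xy.
  have [u ufy] := complete_poset_neq0 (fG _ (complete_poset_set1 yG)).
  have uG : u \in vset G.
    by apply: complete_poset_sub ufy; apply/fG/complete_poset_set1.
  have ufxy : u \in f [set x; y].
    apply: subsetP ufy; rewrite -le_setE.
    by apply: fM; rewrite ?complete_poset_set1 // le_setE subsetUr.
  have vgxy : v \in g [set x; y].
    apply: subsetP vgx; rewrite -le_setE.
    by apply: gM; rewrite ?complete_poset_set1 // le_setE subsetUl.
  have vu : adj G v u.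
    case: cmp => /(_ _ xyG); rewrite le_setE => /subsetP lefg.
      exact: complete_poset_adj rG (gG _ xyG) vgxy (lefg _ ufxy).
    exact: complete_poset_adj rG (fG _ xyG) (lefg _ vgxy) ufxy.
  by rewrite -(If y yA u ufy); apply: rhom.
have eA : A = vset H.
  apply/eqP; rewrite eqEsubset sHA andbT; apply/subsetP=> x xA.
  have fx := fH _ (complete_poset_set1 (AG x xA)).
  have [v vfx] := complete_poset_neq0 fx.
  have vH := complete_poset_sub fx vfx.
  by rewrite -(If x xA v vfx) rid // (subsetP sHA).
split; last by exists s; rewrite -eA.
split=> // x y xH yH; apply/idP/idP=> [/aHG //|xy].
(* The retraction maps [[set x; y]] to a complete subgraph of [H] that still
   contains the fixed sets [[set x]] and [[set y]]. *)
have xyG := complete_poset_set2 xy.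
have inf z : z \in vset H -> z \in [set x; y] -> z \in f [set x; y].
  move=> zH; have := fM _ _ (complete_poset_set1 (subsetP sHG z zH)) xyG.
  by rewrite (fid _ (complete_poset_set1 zH)) !le_setE !sub1set.
by apply: (complete_poset_adj rH (fH _ xyG)); apply: inf;
   rewrite // !inE eqxx ?orbT.
Qed.

End CompletePoset.

Lemma add_loops_reflexive (V : finType) (G : graph V) :
  reflexive_graph (add_loops G).
Proof. by move=> x xG; rewrite /= /loop_adj eqxx xG orbT. Qed.

Lemma add_loops_subgraph (V : finType) (G H : graph V) :
  subgraph H G -> subgraph (add_loops H) (add_loops G).
Proof.
case=> sHG aHG; split=> // x y; rewrite /= /loop_adj.
by case/orP=> [/aHG->//|/andP[-> /(subsetP sHG)->]]; rewrite orbT.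
Qed.

Theorem theorem3p3 (V : finType) (G H : graph V)
  (hHG : subgraph H G)
  (hC : poset_dismantles (complete_poset G) (complete_poset H)) :
  graph_dismantles (add_loops G) (add_loops H) /\
  (reflexive_graph G -> reflexive_graph H -> graph_dismantles G H).
Proof.
split=> [|rG rH]; last exact: reflexive_complete_dismantles.
apply: reflexive_complete_dismantles; try exact: add_loops_reflexive.
  exact: add_loops_subgraph.
by rewrite !complete_poset_add_loops.
Qed.
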